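(* For all positive integers $s$ and $n\ge 2$, the graph $K_{1,s}\times P_n$ is antimagic, except in the three cases $(s,n)\in\{(1,2),(1,3),(2,2)\}$.
   Context: $K_{1,s}$ denotes the star with one center and $s$ leaves, and $P_n$ denotes the path on $n$ vertices. For graphs $G$ and $H$, the direct product $G\times H$ has vertex set $V(G)\times V(H)$, with $(x,y)$ adjacent to $(x',y')$ if and only if $xx'\in E(G)$ and $yy'\in E(H)$. A (possibly disconnected) graph $G$ is antimagic if there is a bijection $f:E(G)\to\{1,2,\dots,|E(G)|\}$ such that the vertex sums $\sum_{e\ni v} f(e)$ (sum of labels of edges incident with $v$) are pairwise distinct over all vertices $v$ of $G$. *)

(* Defs.v *)
From HB Require Import structures.
From mathcomp Require Import all_boot.

Set Implicit Arguments.
Unset Strict Implicit.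
Unset Printing Implicit Defensive.

Record sgraph := SGraph {
  vertex :> finType;
  adj : rel vertex;
  adj_sym : symmetric adj;
  adj_irrefl : irreflexive adj
}.

Definition edges (G : sgraph) : {set {set G}} :=
  [set e : {set G} | [exists x, exists y, adj x y && (e == [set x; y])]].

(* The center is [ord0]; the leaves are the s other elements of 'I_s.+1. *)
Definition star_adj (s : nat) : rel 'I_s.+1 :=
  fun i j => (i == ord0) != (j == ord0).

Lemma star_adj_sym s : symmetric (@star_adj s).
Proof. by move=> i j; rewrite /star_adj eq_sym. Qed.

Lemma star_adj_irrefl s : irreflexive (@star_adj s).
Proof. by move=> i; rewrite /star_adj eqxx. Qed.

Definition star (s : nat) : sgraph :=
  SGraph (@star_adj_sym s) (@star_adj_irrefl s).

Definition path_adj (n : nat) : rel 'I_n :=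
  fun i j => (i.+1 == j :> nat) || (j.+1 == i :> nat).

Lemma path_adj_sym n : symmetric (@path_adj n).
Proof. by move=> i j; rewrite /path_adj orbC. Qed.

Lemma path_adj_irrefl n : irreflexive (@path_adj n).
Proof. by move=> i; rewrite /path_adj orbb eqn_leq ltnn. Qed.

Definition path_graph (n : nat) : sgraph :=
  SGraph (@path_adj_sym n) (@path_adj_irrefl n).

Definition direct_adj (G H : sgraph) : rel (G * H)%type :=
  fun u v => adj u.1 v.1 && adj u.2 v.2.

Lemma direct_adj_sym G H : symmetric (@direct_adj G H).
Proof.
by move=> u v; rewrite /direct_adj (adj_sym u.1) (adj_sym u.2).
Qed.

Lemma direct_adj_irrefl G H : irreflexive (@direct_adj G H).
Proof. by move=> u; rewrite /direct_adj adj_irrefl. Qed.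

Definition direct_product (G H : sgraph) : sgraph :=
  SGraph (@direct_adj_sym G H) (@direct_adj_irrefl G H).

(* Only the values of f on [edges G] matter. *)
Definition edge_labeling (G : sgraph) (f : {set G} -> nat) : Prop :=
  {in edges G &, injective f} /\
  (forall k : nat,
     (1 <= k <= #|edges G|) <-> (exists2 e, e \in edges G & f e = k)).

Definition vertex_sum (G : sgraph) (f : {set G} -> nat) (v : G) : nat :=
  \sum_(e in edges G | v \in e) f e.

Definition antimagic (G : sgraph) : Prop :=
  exists f : {set G} -> nat, edge_labeling f /\ injective (vertex_sum f).

(* Main.v *)
Require Import Defs.
From mathcomp Require Import all_boot.
From mathcomp Require Import zify.

(** Write [n = m + 1].  The edges of [K_{1,s} x P_n] join a centre vertex of one
    level to a leaf vertex of a neighbouring level, so an inner leaf vertex has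
    degree 2 and a centre vertex degree [2 s] or [s].

    For [s >= 2], give the pendant edges the labels [1 .. 2 s] and the two edges at
    each inner leaf vertex two consecutive labels [2 k + 1, 2 k + 2], increasing with
    the level.  The leaf sums are then [1 .. 2 s] and distinct numbers congruent to
    3 modulo 4, whichever of the two edges receives the larger label.  This choice
    is free, and is encoded by the number [t j] of leaves of level [j] whose larger
    label goes down.  A suitable [t] keeps the centre sums away from 3 modulo 4
    (one centre sum with [m = 2] exceeds all leaf sums instead), and
    the centre sums are told apart by their residues modulo [2 s ^ 2].

    For [s = 1] the graph is two disjoint paths.  One is labelled
    [1, 5, 9, .., 10, 6, 2], the other [3, 7, 11, .., 12, 8, 4] (with the largest
    label [2 m] in the middle of the latter if [m] is odd).  Away from the middles
    the sums of adjacent labels lie in the four different even classes modulo 8.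

    The three exceptional graphs are two disjoint edges, or two disjoint paths with
    two edges: there, with labels [{a, b}] and [{c, d}], both [a + b] and [c + d]
    would have to exceed 4 and differ, while their total is 10. *)

Set Implicit Arguments.
Unset Strict Implicit.
Unset Printing Implicit Defensive.

(** * Antimagic labelings through an indexing of the edges *)

(** Surjectivity is automatic: labels shifted down by one inject [E] into an ordinal of the same
    size. *)
Lemma antimagic_of_indexing (G : sgraph) (E : finType) (ed : E -> {set G})
    (lab : E -> nat) :
  injective ed -> (forall e, (e \in edges G) = (e \in codom ed)) ->
  injective lab -> (forall x, 0 < lab x <= #|E|) ->
  injective (fun v => \sum_(x | v \in ed x) lab x) ->
  antimagic G.
Proof.
move=> ed_inj edgesE lab_inj lab_bnd sum_inj.
pose f e := if [pick x | ed x == e] is Some x then lab x else 0.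
have fE x : f (ed x) = lab x.
  by rewrite /f; case: pickP => [y /eqP/ed_inj -> //|/(_ x)]; rewrite eqxx.
have edgesI : edges G = ed @: [set: E].
  apply/setP => e; rewrite edgesE; apply/codomP/imsetP => [[x ->]|[x _ ->]].
    by exists x.
  by exists x.
have cardE : #|edges G| = #|E| by rewrite edgesI card_imset // cardsT.
exists f; split; first split.
- move=> e1 e2; rewrite !edgesE => /codomP[x ->] /codomP[y ->].
  by rewrite !fE => /lab_inj ->.
- move=> k; rewrite cardE; split=> [/andP[k_gt0 k_le]|[e]]; last first.
    by rewrite edgesE => /codomP[x ->] <-; rewrite fE.
  have lt_lab x : (lab x).-1 < #|E| by have := lab_bnd x; lia.
  pose h x := Ordinal (lt_lab x).
  have h_inj : injective h.
    move=> x y [] hxy; apply: lab_inj.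
    by have := lab_bnd x; have := lab_bnd y; lia.
  have [h' _ hK] := inj_card_bij h_inj (eq_leq (card_ord _)).
  have k_lt : k.-1 < #|E| by lia.
  exists (ed (h' (Ordinal k_lt))); first by rewrite edgesE codom_f.
  rewrite fE; have /(congr1 val)/= := hK (Ordinal k_lt).
  move: (lab_bnd (h' (Ordinal k_lt))) k_gt0.
  by case: (lab _) => // l _; case: (k) => // k1 _ /= ->.
have sumE v : vertex_sum f v = \sum_(x | v \in ed x) lab x.
  rewrite /vertex_sum edgesI big_imset_cond /=; last by move=> x y _ _ /ed_inj.
  by apply: eq_big => [x|x _]; rewrite ?inE ?fE.
by move=> u v; rewrite !sumE => /sum_inj.
Qed.

(** * Edges and vertex sums of the product in coordinates *)

Section StarPath.
Variables s m : nat.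

Let G := direct_product (star s) (path_graph m.+1).

(* [b = false]: from centre [g] up to leaf [i] of level [g.+1];
   [b = true]: from leaf [i] of level [g] up to centre [g.+1]. *)
Definition spedge (b : bool) (g i : nat) : {set G} :=
  if b then [set (inord i.+1 : star s, inord g : path_graph m.+1);
                 (ord0 : star s, inord g.+1 : path_graph m.+1)]
  else [set (ord0 : star s, inord g : path_graph m.+1);
            (inord i.+1 : star s, inord g.+1 : path_graph m.+1)].

(** Vertex sum at star vertex [i] of level [j]; the centre is 0, and leaf [i'] is vertex [i'.+1]. *)
Definition spsum (lab : bool -> nat -> nat -> nat) (i j : nat) : nat :=
  if i is i'.+1 then
    (if 0 < j then lab false j.-1 i' else 0) + (if j < m then lab true j i' else 0)
  else
    (if j < m then \sum_(k < s) lab false j k else 0) +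
    (if 0 < j then \sum_(k < s) lab true j.-1 k else 0).

Lemma mem_spedge b g i (v : G) : g < m -> i < s ->
  (v \in spedge b g i) =
  ((v.1 == 0 :> nat) && (v.2 == g + b :> nat))
  || ((v.1 == i.+1 :> nat) && (v.2 == g + ~~ b :> nat)).
Proof.
move=> lt_g lt_i; case: v => v1 v2.
by case: b; rewrite /spedge !inE !xpair_eqE -!val_eqE /= !inordK; lia.
Qed.

Lemma spedge_inj b g i b' g' i' :
  g < m -> i < s -> g' < m -> i' < s -> spedge b g i = spedge b' g' i' ->
  [/\ b = b', g = g' & i = i'].
Proof.
move=> lt_g lt_i lt_g' lt_i' eq_ed.
have lt1 : g + b < m.+1 by lia.
have lt2 : g + ~~ b < m.+1 by lia.
(* The centre end and the leaf end of the first edge are tested for membership in the second. *)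
have lt3 : i.+1 < s.+1 by [].
have := mem_spedge b (ord0 : star s, Ordinal lt1 : path_graph m.+1) lt_g lt_i.
rewrite eq_ed mem_spedge //= eqxx => e1.
have := mem_spedge b (Ordinal lt3 : star s, Ordinal lt2 : path_graph m.+1) lt_g lt_i.
rewrite eq_ed mem_spedge //= !eqxx => e2.
by case: b b' e1 e2 {eq_ed lt1 lt2} => [] [] /= e1 e2; split; lia.
Qed.

Lemma spedgeP (e : {set G}) :
  reflect (exists b g i, [/\ g < m, i < s & e = spedge b g i]) (e \in edges G).
Proof.
rewrite inE; apply: (iffP existsP) => [[x /existsP[y /andP[]]]|].
  case: x y => [x1 x2] [y1 y2] + /eqP ->; rewrite /= /direct_adj /= /star_adj /path_adj.
  rewrite -!val_eqE /= => adjxy.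
  have ? := ltn_ord x1; have ? := ltn_ord y1.
  have ? := ltn_ord x2; have ? := ltn_ord y2.
  (* Exactly one of [x1], [y1] is 0, so their sum is the leaf vertex. The edge has type [false] when
     its centre end is the lower one. *)
  exists ((x1 == 0 :> nat) (+) (x2.+1 == y2 :> nat)), (minn x2 y2), (x1 + y1).-1.
  split; try by lia.
  apply/setP => -[v1 v2].
  rewrite mem_spedge /=; try by lia.
  rewrite !inE !xpair_eqE -!val_eqE /=.
  have ? := ltn_ord v1; have ? := ltn_ord v2.
  by lia.
move=> [b [g [i [lt_g lt_i ->]]]].
have adjp (j j' : 'I_m.+1) : j.+1 = j' -> path_adj j j'.
  by rewrite /path_adj => ->; rewrite eqxx.
have jP : (inord g : 'I_m.+1).+1 = (inord g.+1 : 'I_m.+1) by rewrite !inordK //; lia.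
case: b.
  exists (inord i.+1 : star s, inord g : path_graph m.+1); apply/existsP.
  exists (ord0 : star s, inord g.+1 : path_graph m.+1).
  rewrite eqxx andbT /= /direct_adj /= adjp // andbT /star_adj -!val_eqE /= inordK //.
exists (ord0 : star s, inord g : path_graph m.+1); apply/existsP.
exists (inord i.+1 : star s, inord g.+1 : path_graph m.+1).
by rewrite eqxx andbT /= /direct_adj /= adjp // andbT /star_adj -!val_eqE /= inordK.
Qed.

Let E := (bool * 'I_m * 'I_s)%type.
Let ed (x : E) := spedge x.1.1 x.1.2 x.2.

Lemma ed_inj : injective ed.
Proof.
move=> [[b g] i] [[b' g'] i'] /spedge_inj[] //= -> /val_inj -> /val_inj ->.
by [].
Qed.

Lemma mem_edges e : (e \in edges G) = (e \in codom ed).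
Proof.
apply/spedgeP/codomP => [[b [g [i [lt_g lt_i ->]]]]|[[[b g] i] ->]].
  by exists (b, Ordinal lt_g, Ordinal lt_i).
by exists b, g, i.
Qed.

Lemma card_E : #|{: E}| = 2 * m * s.
Proof. by rewrite !card_prod card_bool !card_ord. Qed.

Lemma sum_ord_eq (N k a : nat) (F : nat -> nat) :
  \sum_(i < N) (if k == i + a then F i else 0) =
  if (a <= k) && (k - a < N) then F (k - a) else 0.
Proof.
case: ifP => [/andP[le_ak lt_k]|nk].
  rewrite (bigD1 (Ordinal lt_k)) //= subnK // eqxx big1 ?addn0 // => i.
  by rewrite -val_eqE /= => ne_i; case: eqP => // eki; lia.
by apply: big1 => i _; case: eqP => // eki; have := ltn_ord i; lia.
Qed.

Lemma spsumE (lab : bool -> nat -> nat -> nat) (v : G) :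
  \sum_(x : E | v \in ed x) lab x.1.1 x.1.2 x.2 = spsum lab v.1 v.2.
Proof.
case: v => [v1 v2] /=.
pose F b g i := if ((v1, v2) : G) \in spedge b g i then lab b g i else 0.
transitivity (\sum_(b : bool) \sum_(g < m) \sum_(i < s) F b g i).
  rewrite big_mkcond /= pair_bigA /= pair_bigA /=.
  by apply: eq_bigr => -[[b g] i] _.
have lt_v2 := ltn_ord v2; have lt_v1 := ltn_ord v1.
rewrite big_bool /= addnC /spsum.
case Ev1: (v1 : nat) => [|i'].
  congr (_ + _).
    transitivity (\sum_(g < m) if v2 == g + 0 :> nat then \sum_(k < s) lab false g k else 0).
      apply: eq_bigr => g _; rewrite /F; under eq_bigr do rewrite mem_spedge //= Ev1 eqxx orbF.
      by case: eqP => // _; rewrite big1.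
    by rewrite (sum_ord_eq _ _ _ (fun g => \sum_(k < s) lab false g k)) subn0 leq0n.
  transitivity (\sum_(g < m) if v2 == g + 1 :> nat then \sum_(k < s) lab true g k else 0).
    apply: eq_bigr => g _; rewrite /F; under eq_bigr do rewrite mem_spedge //= Ev1 eqxx orbF.
    by case: eqP => // _; rewrite big1.
  rewrite (sum_ord_eq _ _ _ (fun g => \sum_(k < s) lab true g k)) subn1.
  by congr (if _ then _ else _); lia.
have lt_i' : i' < s by rewrite -ltnS -Ev1.
have inner b g : g < m -> \sum_(i < s) F b g i =
    if v2 == g + ~~ b :> nat then lab b g i' else 0.
  move=> lt_g; transitivity (\sum_(i < s) if i' == i + 0 then
     (if v2 == g + ~~ b :> nat then lab b g i else 0) else 0).
    apply: eq_bigr => i _; rewrite /F mem_spedge //= Ev1 /= eqSS addn0.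
    by case: eqP => //= _; case: eqP.
  by rewrite (sum_ord_eq _ _ _ (fun i => if _ then lab b g i else 0)) subn0 lt_i'.
under eq_bigr do rewrite inner //; rewrite /=.
rewrite (sum_ord_eq _ _ _ (fun g => lab false g i')) subn1.
under [X in _ + X]eq_bigr do rewrite inner //; rewrite /=.
rewrite (sum_ord_eq _ _ _ (fun g => lab true g i')) subn0.
by congr (_ + _); congr (if _ then _ else _); lia.
Qed.

Lemma antimagic_star_path :
  antimagic G <->
  exists lab : bool -> nat -> nat -> nat,
  [/\ forall b g i b' g' i', g < m -> i < s -> g' < m -> i' < s ->
        lab b g i = lab b' g' i' -> [/\ b = b', g = g' & i = i'],
      forall b g i, g < m -> i < s -> 0 < lab b g i <= 2 * m * s &
      forall i j i' j', i <= s -> j <= m -> i' <= s -> j' <= m ->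
        spsum lab i j = spsum lab i' j' -> i = i' /\ j = j'].
Proof.
split=> [[f [[f_inj f_onto] sum_inj]]|[lab [lab_inj lab_bnd sum_inj]]].
  have ed_edge b g i : g < m -> i < s -> spedge b g i \in edges G.
    by move=> *; apply/spedgeP; exists b, g, i.
  have edgesI : edges G = ed @: [set: E].
    apply/setP => e; rewrite mem_edges; apply/codomP/imsetP => [[x ->]|[x _ ->]];
    by exists x.
  exists (fun b g i => f (spedge b g i)); split.
  - move=> b g i b' g' i' *; apply: spedge_inj => //.
    by apply: f_inj => //; exact: ed_edge.
  - move=> b g i lt_g lt_i; rewrite -card_E -cardsT -(card_imset _ ed_inj) -edgesI.
    by apply/f_onto; exists (spedge b g i) => //; exact: ed_edge.
  - move=> i j i' j' le_i le_j le_i' le_j' eq_sum.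
    have vsumE (v : G) : vertex_sum f v = spsum (fun b g i => f (spedge b g i)) v.1 v.2.
      rewrite -spsumE /vertex_sum edgesI big_imset_cond /=; last by move=> x y _ _ /ed_inj.
      by apply: eq_bigl => x; rewrite inE.
    have := sum_inj (inord i : star s, inord j : path_graph m.+1)
                    (inord i' : star s, inord j' : path_graph m.+1).
    rewrite !vsumE /= !inordK // => /(_ eq_sum)[].
    by move=> /(congr1 val) + /(congr1 val); rewrite /= !inordK.
apply: (@antimagic_of_indexing G E ed (fun x => lab x.1.1 x.1.2 x.2)).
- exact: ed_inj.
- exact: mem_edges.
- move=> [[b g] i] [[b' g'] i'] /= /lab_inj[] // -> /val_inj -> /val_inj ->.
  by [].
- by move=> [[b g] i] /=; rewrite card_E; exact: lab_bnd.
- move=> [v1 v2] [w1 w2] /=; rewrite !spsumE /=.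
  move=> /sum_inj[]; rewrite -1?ltnS //= => /val_inj -> /val_inj ->.
  by [].
Qed.

End StarPath.

(** * The twisted labeling for [s >= 2] *)

Lemma euclid_uniq d q r q' r' :
  d * q + r = d * q' + r' -> r < d -> r' < d -> q = q' /\ r = r'.
Proof.
move=> eq_n lt_r lt_r'; have d_gt0 : 0 < d by lia.
suff eq_q : q = q' by split=> //; move: eq_n; rewrite eq_q => /addnI.
have := congr1 (fun k => k %/ d) eq_n.
by rewrite /= ![d * _]mulnC !divnMDl // !divn_small // !addn0.
Qed.

Section TwistedLabeling.
Variables (s m : nat) (t : nat -> nat).

(* The level of the leaf end of an edge; level [m] is identified with level [0],
   so that the pendant edges of both extreme levels share a block of labels. *)
Definition level_row (b : bool) (g : nat) : nat :=
  if b then g else if g.+1 < m then g.+1 else 0.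

(** At an inner leaf vertex, type [false] is the downward edge. Row 0 instead pairs the pendant
    edges of levels [m] (type [false]) and 0. *)
Definition twist_lab (b : bool) (g i : nat) : nat :=
  (2 * (s * level_row b g + i)).+1 + (b (+) (i < t (level_row b g))).

Lemma twist_lab_inj b g i b' g' i' : g < m -> i < s -> g' < m -> i' < s ->
  twist_lab b g i = twist_lab b' g' i' -> [/\ b = b', g = g' & i = i'].
Proof.
move=> lt_g lt_i lt_g' lt_i'; rewrite /twist_lab.
set r := level_row b g; set r' := level_row b' g' => eq_lab.
have eq_k : s * r + i = s * r' + i' by lia.
have [eq_r eq_i] := euclid_uniq eq_k lt_i lt_i'.
move: eq_lab; rewrite -eq_r -eq_i => /addnI eq_b.
have {}eq_b : b = b' by move: eq_b; case: (b) (b') (i < t r) => [] [] [].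
move: eq_r; rewrite /r /r' -eq_b /level_row.
by case: (b) => [->//|]; case: ifP => ?; case: ifP => ? ?; split=> //; lia.
Qed.

Lemma twist_lab_bound b g i : g < m -> i < s -> 0 < twist_lab b g i <= 2 * m * s.
Proof.
move=> lt_g lt_i; rewrite /twist_lab.
have : level_row b g < m by rewrite /level_row; case: b => //; case: ifP => //; lia.
by move: (level_row b g) => r lt_r; nia.
Qed.

Lemma twist_leaf_first i : 0 < m -> i < s -> t 0 = s ->
  spsum s m twist_lab i.+1 0 = i.*2.+1.
Proof. by move=> m_gt0 lt_i t0; rewrite /= m_gt0 /twist_lab /= t0 lt_i; lia. Qed.

Lemma twist_leaf_last i : 0 < m -> i < s -> t 0 = s ->
  spsum s m twist_lab i.+1 m = i.*2.+2.
Proof.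
move=> m_gt0 lt_i t0.
by rewrite /= ltnn m_gt0 /twist_lab /= prednK // ltnn t0 lt_i; lia.
Qed.

Lemma twist_leaf_inner i j : 0 < j < m ->
  spsum s m twist_lab i.+1 j = 4 * (s * j + i) + 3.
Proof.
by case: j => //= j lt_j; rewrite lt_j /twist_lab /= lt_j; case: (i < _); lia.
Qed.

Hypothesis t_le : forall r, t r <= s.

Lemma sum_twist_lab b g :
  \sum_(i < s) twist_lab b g i =
  2 * (s * s) * level_row b g + s * s +
  (if b then s - t (level_row b g) else t (level_row b g)).
Proof.
rewrite /twist_lab; move: (level_row b g) => r; have := t_le r; move: (t r) => x le_x.
have cnt N : \sum_(i < N) (i < x) = minn N x.
  by elim: N => [|N IH]; rewrite ?big_ord0 ?min0n // big_ord_recr /= IH; lia.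
have cntC N : \sum_(i < N) ~~ (i < x) = N - x.
  by elim: N => [|N IH]; rewrite ?big_ord0 // big_ord_recr /= IH; lia.
have lin N : \sum_(i < N) (2 * (s * r + i)).+1 = 2 * s * r * N + N * N.
  by elim: N => [|N IH]; rewrite ?big_ord0 ?muln0 // big_ord_recr /= IH; lia.
rewrite big_split /= lin; case: b => /=; rewrite ?cnt ?cntC; nia.
Qed.

Lemma twist_center_first : 1 < m ->
  spsum s m twist_lab 0 0 = 2 * (s * s) * 1 + (s * s + t 1).
Proof. by move=> m_gt1; rewrite /= ltnW // sum_twist_lab /= m_gt1; lia. Qed.

(** Rows [j.+1] and [j.-1] give [2 s ^ 2 * 2 j]; the two terms [s ^ 2] add one more multiple of
    [2 s ^ 2]. *)
Lemma twist_center_inner j : 0 < j -> j.+1 < m ->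
  spsum s m twist_lab 0 j =
  2 * (s * s) * j.*2.+1 + (s + t j.+1 - t j.-1).
Proof.
case: j => //= j _ lt_j; rewrite ltnW // !sum_twist_lab /= lt_j.
by have := t_le j; nia.
Qed.

(** The upward edges end at level [m], hence lie in row 0. *)
Lemma twist_center_penult : 1 < m -> t 0 = s ->
  spsum s m twist_lab 0 m.-1 = 2 * (s * s) * m.-1 + (2 * s - t m.-2).
Proof.
move=> m_gt1 t0.
have [m1_lt m1_gt0 m1K] : [/\ m.-1 < m, 0 < m.-1 & m.-1.+1 = m] by split; lia.
rewrite /= m1_lt m1_gt0 !sum_twist_lab /level_row m1K ltnn t0.
by have := t_le m.-2; nia.
Qed.

Lemma twist_center_last : 0 < m ->
  spsum s m twist_lab 0 m = 2 * (s * s) * m.-1 + (s * s + s - t m.-1).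
Proof. by move=> m_gt0; rewrite /= ltnn m_gt0 sum_twist_lab /=; have := t_le m.-1; lia. Qed.

End TwistedLabeling.

(** * Choice of the twist and separation of the centre sums *)

(** For even [s] all centre sums are even. For odd [s], an inner one ([1 < j < m - 1]) is
    [2 + s + t j.+1 - t j.-1] modulo 4: a constant [t] suffices if [s] is 3 modulo 4, while the
    pattern 2, 2, 0, 0 shifts it by 2 if [s] is 1 modulo 4. The value [t 1 = 2] makes the first
    centre sum [3 s ^ 2 + 2], which is 1 modulo 4. *)
Definition twist (s j : nat) : nat :=
  if j == 0 then s
  else if ~~ odd s then 0
  else if (s %% 4 == 3) || (j %% 4 == 1) || (j %% 4 == 2) then 2 else 0.

Lemma twist_le s r : 2 <= s -> twist s r <= s.
Proof. by move=> s2; rewrite /twist; do 3?case: ifP => //. Qed.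

Lemma twist_small s j : 0 < j -> 
  twist s j = (odd s).*2 \/ s %% 4 = 1 /\ 2 < j /\ twist s j = 0.
Proof.
case: j => // j _; rewrite /twist /=; case: ifP => s1; first by lia.
by case: ifP => j1; lia.
Qed.

Lemma twist_step s j : 0 < j ->
  s %% 4 <> 1 /\ twist s j.+2 = twist s j \/
  s %% 4 = 1 /\ (twist s j = 0 /\ twist s j.+2 = 2 \/
                twist s j = 2 /\ twist s j.+2 = 0).
Proof.
case: j => // j _; rewrite /twist /=; case: ifP => s1; first by lia.
by case: ifP => j1; case: ifP => j2; lia.
Qed.

Section TwistedCenters.
Variables s m : nat.
Hypotheses (s_ge2 : 2 <= s) (m_ge2 : 2 <= m).

Let C := spsum s m (twist_lab s m (twist s)) 0.

Let t_le := fun r => twist_le r s_ge2.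

(** Linear bounds on [s * s], for use by [lia]. *)
Let sqr_ge : s = 2 /\ s * s = 4 \/ 3 <= s /\ 3 * s <= s * s.
Proof. by case: (ltngtP s 2) => [|s3|->]; [lia | right; nia | left]. Qed.

(* [q] and [r] are the quotient and remainder of the sum modulo [2 * s ^ 2]. *)
Variant center_kind (j q r : nat) : Prop :=
| CenterFirst of j = 0 & q = 1 & r = s * s + (odd s).*2
| CenterSecond of j = 1 & 2 < m & q = 3 & r = (odd s).*2
| CenterInner of 1 < j & j.+1 < m & q = j.*2.+1 &
    s %% 4 <> 1 /\ r = s \/ s %% 4 = 1 /\ (r = s + 2 \/ r + 2 = s)
| CenterPenult of j = m.-1 & 2 < m & q = m.-1 &
    r + (odd s).*2 = 2 * s \/ r = 2 * s
| CenterMiddle of j = 1 & m = 2 & q = 1 & r = s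
| CenterLast of j = m & q = m.-1 &
    r + (odd s).*2 = s * s + s \/ 2 < m /\ r = s * s + s.

Lemma center_kindP j : j <= m ->
  exists q r, C j = 2 * (s * s) * q + r /\ center_kind j q r.
Proof.
move=> le_j; have t0 : twist s 0 = s by [].
have [-> | j_gt0] := posnP j.
  exists 1, (s * s + twist s 1); split; first exact: twist_center_first.
  by apply: CenterFirst => //; have := twist_small s (ltn0Sn 0); lia.
have [lt_j|ge_j] := ltnP j.+1 m.
  exists j.*2.+1, (s + twist s j.+1 - twist s j.-1); split.
    exact: twist_center_inner.
  case: j j_gt0 lt_j {le_j} => [|[|j]] // _ lt_j.
    by apply: CenterSecond; have := twist_small s (ltn0Sn 1); rewrite /= ?t0; lia.
  apply: CenterInner => //.
  by have := twist_step s (ltn0Sn j); rewrite /=; lia.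
have [lt_j|{}ge_j] := ltnP j m.
  have -> : j = m.-1 by lia.
  exists m.-1, (2 * s - twist s m.-2); split; first exact: twist_center_penult.
  have [m3|m2] := ltnP 2 m; last first.
    have eq_m : m = 2 by lia.
    by apply: CenterMiddle; rewrite eq_m //= t0; lia.
  have m0 : 0 < m.-2 by lia.
  by apply: CenterPenult => //; have := twist_small s m0; lia.
have -> : j = m by lia.
exists m.-1, (s * s + s - twist s m.-1); split.
  by apply: twist_center_last => //; lia.
have m0 : 0 < m.-1 by lia.
by apply: CenterLast => //; have := twist_small s m0; have := sqr_ge; lia.
Qed.

Lemma center_kind_lt j q r : center_kind j q r -> r < 2 * (s * s).
Proof. by case; have := sqr_ge; lia. Qed.

(** Below level [m - 1] the quotients [2 j + 1] are distinct. The last two centres share [m - 1],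
    and remainders settle every coincidence. *)
Lemma twist_center_inj j j' : j <= m -> j' <= m -> C j = C j' -> j = j'.
Proof.
move=> /center_kindP[q [r [-> kj]]] /center_kindP[q' [r' [-> kj']]] eqC.
have [] := euclid_uniq eqC (center_kind_lt kj) (center_kind_lt kj').
move: sqr_ge => {eqC} sqrP.
by case: kj => ? ? ?; case: kj' => ? ? ?; lia.
Qed.

Lemma twist_center_gt j : j <= m -> 2 * s < C j.
Proof.
move=> /center_kindP[q [r [-> kj]]].
have : 2 * (s * s) <= 2 * (s * s) * q by rewrite leq_pmulr //; case: kj; lia.
move: sqr_ge => sqrP; case: kj => * ; lia.
Qed.

(** Only the middle centre for [m = 2], with sum [2 s ^ 2 + s], can be 3 modulo 4; then [s] is 1
    modulo 4, so [s >= 5]. *)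
Lemma twist_center_mod4 j : j <= m -> C j %% 4 = 3 -> 8 * s <= C j /\ m = 2.
Proof.
move=> /center_kindP[q [r [-> kj]]].
have [b eqS] : exists b, s * s = 4 * b + odd s.
  exists ((s * s) %/ 4); rewrite {1}(divn_eq (s * s) 4) -modnMm.
  have : s %% 4 < 4 by rewrite ltn_mod.
  by move: (s %% 4) (modn_dvdm s (isT : 2 %| 4)) => [|[|[|[|]]]] //; lia.
have : s %% 4 = 1 -> s < 2 \/ 5 * s <= s * s.
  by move=> s1; case: (ltnP s 5) => s5; [lia|right; nia].
have : 2 * (s * s) <= 2 * (s * s) * q by rewrite leq_pmulr //; case: kj; lia.
have [B ->] : exists B, 2 * (s * s) * q = 4 * B + (if odd s then 2 * q else 0).
  by exists (2 * b * q); rewrite eqS; case: odd; lia.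
by case: ifP => s_odd; case: kj; lia.
Qed.

End TwistedCenters.

Lemma star_path_antimagic_ge2 s m : 2 <= s -> 1 <= m -> (s != 2) || (m != 1) ->
  antimagic (direct_product (star s) (path_graph m.+1)).
Proof.
move=> s_ge2 m_ge1 nsm; apply/antimagic_star_path.
have t_le r := twist_le r s_ge2; have t0 : twist s 0 = s by [].
exists (twist_lab s m (twist s)); split.
- exact: twist_lab_inj.
- exact: twist_lab_bound.
set V := spsum s m _.
have leafP i j : i < s -> j <= m ->
    [\/ j = 0 /\ V i.+1 j = i.*2.+1, j = m /\ V i.+1 j = i.*2.+2 |
        0 < j < m /\ V i.+1 j = 4 * (s * j + i) + 3].
  move=> lt_i le_j; have [->|j0] := posnP j.
    by apply: Or31; split=> //; exact: twist_leaf_first.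
  have [->|nj] := eqVneq j m; first by apply: Or32; split=> //; exact: twist_leaf_last.
  have j_in : 0 < j < m by lia.
  by apply: Or33; split; [lia | exact: twist_leaf_inner].
have leaf_inj i j i' j' : i < s -> j <= m -> i' < s -> j' <= m ->
    V i.+1 j = V i'.+1 j' -> i.+1 = i'.+1 /\ j = j'.
  move=> lt_i le_j lt_i' le_j'.
  case: (leafP i j lt_i le_j) => -[jP ->]; case: (leafP i' j' lt_i' le_j') => -[jP' ->];
    try by nia.
  move=> eqV; have eq_n : s * j + i = s * j' + i' by lia.
  by have [-> ->] := euclid_uniq eq_n lt_i lt_i'.
have center_leaf i j j' : i < s -> j <= m -> j' <= m -> V i.+1 j <> V 0 j'.
  move=> lt_i le_j le_j'; have [m_ge2|m_lt2] := leqP 2 m.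
    have := twist_center_gt s_ge2 m_ge2 le_j'.
    have := twist_center_mod4 s_ge2 m_ge2 le_j'.
    rewrite -/V; case: (leafP i j lt_i le_j) => -[jP ->]; try by lia.
    move=> mod4 _ eqV; rewrite -eqV in mod4.
    have [|le_V eq_m] := mod4; first by rewrite -modnDm mulnC modnMl.
    (* Leaf sums at level 1 are at most [8 s - 1]. *)
    have eq_j : j = 1 by lia.
    by rewrite eq_j in le_V; lia.
  have eq_m : m = 1 by lia.
  have -> : V 0 j' = s * s + (if j' == 0 then s else 0).
    rewrite /V /spsum eq_m; move: le_j'; rewrite eq_m.
    by case: j' => [|[|//]] _ /=; rewrite sum_twist_lab //= t0; lia.
  (* For [m = 1] the case [s = 2] is excluded, so [s >= 3]. *)
  have : 2 * s < s * s by nia.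
  by case: (leafP i j lt_i le_j) => -[jP ->]; case: ifP; lia.
have center_inj j j' : j <= m -> j' <= m -> V 0 j = V 0 j' -> j = j'.
  have [m_ge2|m_lt2] := leqP 2 m; first exact: twist_center_inj.
  have eq_m : m = 1 by lia.
  rewrite /V /spsum eq_m; case: j => [|[|//]]; case: j' => [|[|//]] // _ _ /=;
    by rewrite !sum_twist_lab //= t0; lia.
move=> [|i] j [|i'] j' le_i le_j le_i' le_j'.
- by move=> /center_inj ->.
- by move=> /esym/center_leaf[].
- by move=> /center_leaf[].
- exact: leaf_inj.
Qed.

(** * Two disjoint paths: the case [s = 1] *)

Section TwoPaths.
Variable m : nat.

(* Indexed by the component [c] and the position [g] along its path. *)
Definition path_lab (c : bool) (g : nat) : nat :=
  if c then if g.*2.+1 < m then 4 * g + 3 else minn (4 * (m - g)) (2 * m)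
  else if g.*2 < m then 4 * g + 1 else 4 * (m - g) - 2.

(** Edge types alternate along a path, so [b (+) odd g] is constant on each component. *)
Definition two_path_lab (b : bool) (g i : nat) : nat := path_lab (b (+) odd g) g.

Lemma path_lab_inj c g c' g' : g < m -> g' < m ->
  path_lab c g = path_lab c' g' -> c = c' /\ g = g'.
Proof.
move=> lt_g lt_g'; rewrite /path_lab.
by case: c; case: ifP => ?; case: c'; case: ifP => ? ?; split=> //; lia.
Qed.

Definition path_sum (c : bool) (j : nat) : nat :=
  (if 0 < j then path_lab c j.-1 else 0) + (if j < m then path_lab c j else 0).

Lemma path_sum_inj c j c' j' : 3 <= m -> j <= m -> j' <= m ->
  path_sum c j = path_sum c' j' -> c = c' /\ j = j'.
Proof.
move=> m3; rewrite /path_sum /path_lab.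
case: c; case: c'; case: j => [|j]; case: j' => [|j'] /=;
  repeat case: ifP => ?; move=> *; split => //; lia.
Qed.

Lemma spsum_two_path i j : i <= 1 ->
  spsum 1 m two_path_lab i j = path_sum ((i == 1) (+) odd j) j.
Proof.
rewrite /spsum /path_sum /two_path_lab !big_ord1.
by case: i j => [|[|//]] [|j] _ /=; rewrite ?negbK ?addn0 // addnC.
Qed.

Lemma two_path_antimagic : 3 <= m ->
  antimagic (direct_product (star 1) (path_graph m.+1)).
Proof.
move=> m3; apply/antimagic_star_path; exists two_path_lab; split.
- move=> b g [|//] b' g' [|//] lt_g _ lt_g' _ /path_lab_inj[] // + eq_g.
  by rewrite -eq_g => /addIb ->.
- move=> b g [|//] lt_g _; rewrite /two_path_lab /path_lab.
  by repeat case: ifP => ?; lia.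
- move=> i j i' j' le_i le_j le_i' le_j'; rewrite !spsum_two_path //.
  move=> /path_sum_inj[] // + eq_j; rewrite -eq_j => /addIb.
  by case: i i' le_i le_i' => [|[|//]] [|[|//]].
Qed.

End TwoPaths.

(** * The exceptional graphs and the conclusion *)

Lemma no_antimagic4 a b c d :
  all (fun x => 0 < x <= 4) [:: a; b; c; d] ->
  uniq [:: a; b; c; d; a + b; c + d] -> False.
Proof.
by do 5?[case: a => [|a] //]; do 5?[case: b => [|b] //];
   do 5?[case: c => [|c] //]; do 5?[case: d => [|d] //].
Qed.

Lemma not_antimagic_star_path s m : (s, m) \in [:: (1, 1); (1, 2); (2, 1)] ->
  ~ antimagic (direct_product (star s) (path_graph m.+1)).
Proof.
rewrite !inE !xpair_eqE => sm /antimagic_star_path[lab [_ lab_bnd sum_inj]].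
have uniq_sums (vs : seq (nat * nat)) : all (fun v => (v.1 <= s) && (v.2 <= m)) vs ->
    uniq vs -> uniq [seq spsum s m lab v.1 v.2 | v <- vs].
  move=> /allP vsP; rewrite map_inj_in_uniq // => -[i j] [i' j'].
  by move=> /vsP/andP[/= ? ?] /vsP/andP[/= ? ?] /sum_inj[] // -> ->.
case/or3P: sm => /andP[/eqP es /eqP em]; rewrite {}es {}em {sum_inj} in lab_bnd uniq_sums.
(* The two ends of an isolated edge have equal sums. *)
- have := uniq_sums [:: (0, 0); (1, 1)] isT isT.
  by rewrite /= big_ord1 inE addn0 eqxx.
(* The labels are paired by component: path ends have single labels as sums, and each midpoint has
   the sum of a pair. *)
- apply: (@no_antimagic4 (lab false 0 0) (lab true 1 0) (lab false 1 0) (lab true 0 0)).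
    by rewrite /= !lab_bnd.
  have := uniq_sums [:: (0, 0); (0, 2); (1, 2); (1, 0); (1, 1); (0, 1)] isT isT.
  by rewrite [map _ _]/= !big_ord1 !addn0 !add0n.
apply: (@no_antimagic4 (lab false 0 0) (lab false 0 1) (lab true 0 0) (lab true 0 1)).
  by rewrite /= !lab_bnd.
have := uniq_sums [:: (1, 1); (2, 1); (1, 0); (2, 0); (0, 0); (0, 1)] isT isT.
by rewrite [map _ _]/= !big_ord_recl !big_ord0 !addn0 !add0n.
Qed.

Theorem theorem1p3 (s n : nat) (hs : 1 <= s) (hn : 2 <= n) :
  antimagic (direct_product (star s) (path_graph n)) <->
  (s, n) \notin [:: (1, 2); (1, 3); (2, 2)].
Proof.
case: n hn => [//|m] hn.
have -> : ((s, m.+1) \in [:: (1, 2); (1, 3); (2, 2)]) =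
          ((s, m) \in [:: (1, 1); (1, 2); (2, 1)]).
  by rewrite !inE !xpair_eqE !eqSS.
split=> [am|]; first by apply/negP => /not_antimagic_star_path.
rewrite !inE !xpair_eqE => nsm.
have [s2|s1] := leqP 2 s; first by apply: star_path_antimagic_ge2; lia.
have -> : s = 1 by lia.
by apply: two_path_antimagic; lia.
Qed.
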